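(* Let $\theta\in[0,1]$ and let $k_0\ge 0$. Then there is a function $\tau^*:[0,1)^{N_xN_y}\to(0,\infty)$ (depending only on the problem data, the mesh and $\theta$) such that the following holds. Let $(v_k)_{k\ge k_0}$ be vectors in $\mathbb{R}^{N_xN_y}$ with $Mv_{k_0}+g(\varepsilon,v_{k_0})>0$, generated, with time steps $\tau_k$ satisfying $0<\tau_k\le\tau^*(v_k)$ (that is, $\tau_k$ sufficiently small) for $k\ge k_0$, by the scheme $$v_{k+1}=\Phi_k v_k+M^{-1}[\Phi_k-I]\,[\theta g(\varepsilon,v_k)+(1-\theta)g(\varepsilon,v_{k+1})].$$ Then the sequence increases monotonically until unity is reached or exceeded by one or more components of the solution vector (i.e. until quenching occurs): for every $k\ge k_0$ such that $0\le v_j<1$ for all $k_0\le j\le k+1$, one has $v_k<v_{k+1}$.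
   Context: All vector inequalities are componentwise. Mesh: $\mathcal{D}=(-1,1)\times(-1,1)$, $a,b>0$, $N_x,N_y$ are (large) positive integers, $-1=x_0<x_1<\dots<x_{N_x+1}=1$, $-1=y_0<\dots<y_{N_y+1}=1$, $h_{x,i}=x_{i+1}-x_i>0$ ($0\le i\le N_x$), $h_{y,j}=y_{j+1}-y_j>0$ ($0\le j\le N_y$); the mesh is otherwise arbitrary. The degeneracy function $\sigma:\overline{\mathcal{D}}\to[0,\infty)$ vanishes only on a subset of $\partial\mathcal{D}$; $\sigma_{i,j}=\sigma(x_i,y_j)$. Interior grid vectors $v=(v_{1,1},v_{2,1},\dots,v_{N_x,1},v_{1,2},\dots,v_{N_x,N_y})^{T}\in\mathbb{R}^{N_xN_y}$ are ordered lexicographically. Matrices: $B=\mathrm{diag}(\sigma_{1,1}^{-1},\sigma_{2,1}^{-1},\dots,\sigma_{N_x,N_y}^{-1})$ (same ordering); for $\alpha\in\{x,y\}$, $T_\alpha\in\mathbb{R}^{N_\alpha\times N_\alpha}$ is tridiagonal with $(T_\alpha)_{i,i}=-\frac{2}{h_{\alpha,i-1}h_{\alpha,i}}$, $(T_\alpha)_{i,i+1}=\frac{2}{h_{\alpha,i}(h_{\alpha,i-1}+h_{\alpha,i})}$, $(T_\alpha)_{i+1,i}=\frac{2}{h_{\alpha,i}(h_{\alpha,i}+h_{\alpha,i+1})}$; $M_x=a^{-2}B(I_{N_y}\otimes T_x)$, $M_y=b^{-2}B(T_y\otimes I_{N_x})$, $M=M_x+M_y$. With time steps $\tau_k$ and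 $E(A)=e^{A}$ the matrix exponential, $\Phi_{x,k}=E(\tau_kM_x/2)$, $\Phi_{y,k}=E(\tau_kM_y)$, $\Phi_k=\Phi_{x,k}\Phi_{y,k}\Phi_{x,k}$. Reaction term: $\varepsilon=\varepsilon(x,y)$ is a bounded stochastic influence (fixed in time). For each value of $\varepsilon$, $f(\varepsilon,\cdot)$ is a differentiable function on $[0,1)$ with $f(\varepsilon,0)>0$, $f_u(\varepsilon,u)>0$, $\lim_{u\to1^-}f(\varepsilon,u)=\infty$, $\int_0^1 f(\varepsilon,u)\,du=\infty$, and for each $u\in[0,1)$ the values $f(\varepsilon,u)$ are bounded above and bounded below by a positive constant as $\varepsilon$ varies. For $v\in[0,1)^{N_xN_y}$, $g(\varepsilon,v)$ is the vector with components $f(\varepsilon(x_i,y_j),v_{i,j})/\sigma_{i,j}$. *)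

(* Defs.v *)
From HB Require Import structures.
From mathcomp Require Import all_boot all_order all_algebra.
From mathcomp Require Import all_classical all_reals all_analysis.
From mathcomp Require Export mxtens.
Set Implicit Arguments.
Unset Strict Implicit.
Unset Printing Implicit Defensive.
Import Order.TTheory GRing.Theory Num.Theory.
Import numFieldNormedType.Exports.

Local Open Scope classical_set_scope.
Local Open Scope ring_scope.

(* Entrywise sum of the exponential series; [A ^+ k] is the matrix power. *)
Definition expmx (R : realType) (n : nat) (A : 'M[R]_n) : 'M[R]_n :=
  \matrix_(i, j) limn (series (fun k => (A ^+ k) i j / k`!%:R)).

Definition ltcv (R : realType) (n : nat) (u v : 'cV[R]_n) : Prop :=
  forall i, u i 0 < v i 0.

Definition in01 (R : realType) (n : nat) (v : 'cV[R]_n) : Prop :=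
  forall i, 0 <= v i 0 < 1.

Definition square (R : realType) : set (R * R) :=
  `]-1, 1[%classic `*` `]-1, 1[%classic.

(* Only the values z 0, ..., z N.+1 of a grid z with N interior points are
   meaningful. *)
Definition is_grid (R : realType) (N : nat) (z : nat -> R) : Prop :=
  [/\ z 0%N = -1, z N.+1 = 1 & forall i, (i <= N)%N -> z i < z i.+1].

Definition step (R : realType) (z : nat -> R) (i : nat) : R := z i.+1 - z i.

(* Ordinals start at 0, so row i here is row i.+1 in the usual numbering: it
   belongs to the grid point z i.+1, whose adjacent steps are step z i (left)
   and step z i.+1 (right). *)
Definition Tmx (R : realType) (N : nat) (z : nat -> R) : 'M[R]_N :=
  let h := step z in
  \matrix_(i < N, j < N)
    if j == i then - (2 / (h i * h i.+1))
    else if j == i.+1 :> nat then 2 / (h i.+1 * (h i + h i.+1))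
    else if i == j.+1 :> nat then 2 / (h i * (h i + h i.+1))
    else 0.

(* Grid vectors are indexed by 'I_(Ny * Nx), with position j * Nx + i for the
   point (x i.+1, y j.+1): the first coordinate varies fastest, and
   [mxtens_unindex] maps such a position to the pair (j, i). *)
Definition grid_pt (R : realType) (Nx Ny : nat) (x y : nat -> R)
    (p : 'I_(Ny * Nx)) : R * R :=
  let ji := mxtens_unindex p in (x ji.2.+1, y ji.1.+1).

Section Scheme.
Variables (R : realType) (Nx Ny : nat) (a b : R) (x y : nat -> R).
Variable sigma : R * R -> R.

Definition Bmx : 'M[R]_(Ny * Nx) :=
  diag_mx (\row_p (sigma (grid_pt x y p))^-1).

Definition Mx : 'M[R]_(Ny * Nx) :=
  a ^- 2 *: (Bmx *m tensmx (1%:M : 'M[R]_Ny) (Tmx Nx x)).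

Definition My : 'M[R]_(Ny * Nx) :=
  b ^- 2 *: (Bmx *m tensmx (Tmx Ny y) (1%:M : 'M[R]_Nx)).

Definition Mxy : 'M[R]_(Ny * Nx) := Mx + My.

Definition Phi (tau : R) : 'M[R]_(Ny * Nx) :=
  expmx ((tau / 2) *: Mx) *m expmx (tau *: My) *m expmx ((tau / 2) *: Mx).

Definition gvec (eps : R * R -> R) (f : R -> R -> R)
    (v : 'cV[R]_(Ny * Nx)) : 'cV[R]_(Ny * Nx) :=
  \col_p (f (eps (grid_pt x y p)) (v p 0) / sigma (grid_pt x y p)).

Definition scheme_step (eps : R * R -> R) (f : R -> R -> R) (theta tau : R)
    (v v' : 'cV[R]_(Ny * Nx)) : Prop :=
  v' = Phi tau *m v
       + invmx Mxy *m (Phi tau - 1%:M)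
         *m (theta *: gvec eps f v + (1 - theta) *: gvec eps f v').
End Scheme.

Definition is_degeneracy (R : realType) (sigma : R * R -> R) : Prop :=
  (forall p, closure (@square R) p -> 0 <= sigma p) /\
  [set p | closure (@square R) p /\ sigma p = 0]
    `<=` closure (@square R) `\` interior (@square R).

(* Differentiability on [0, 1) with positive derivative is two-sided on ]0, 1[
   and one-sided at 0. *)
Definition is_source (R : realType) (phi : R -> R) : Prop :=
  [/\ forall u : R, 0 < u < 1 -> derivable phi u 1 /\ 0 < derive1 phi u,
      exists2 l : R, 0 < l & h^-1 * (phi h - phi 0) @[h --> 0^'+] --> l,
      0 < phi 0,
      phi u @[u --> 1^'-] --> +oo &
      (\int[lebesgue_measure]_(u in `[0%R, 1%R[) (phi u)%:E = +oo)%E].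

(* [eps] is one realization of the random field; the values of [eps] are those
   it takes on the square. *)
Definition is_reaction (R : realType) (eps : R * R -> R) (f : R -> R -> R) :
    Prop :=
  [/\ [bounded eps p | p in @square R],
      forall p, square p -> is_source (f (eps p)) &
      forall u : R, 0 <= u < 1 -> exists m C : R,
        0 < m /\ forall p, square p -> m <= f (eps p) u <= C].

(* Main.v *)
Require Import Defs.
From mathcomp Require Import all_boot all_order all_algebra.
From mathcomp Require Import all_classical all_reals all_analysis.
From mathcomp Require Import ring lra.
Set Implicit Arguments.
Unset Strict Implicit.
Unset Printing Implicit Defensive.
Import Order.TTheory GRing.Theory Num.Theory.
Import numFieldNormedType.Exports.
Local Open Scope ring_scope.

(** Write M for [Mxy], g(v) for [gvec], X(t) for M^-1 (Phi t - 1),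
    and call w(v) = M v + g(v) the slope at v: it is the velocity of the
    semidiscrete problem dv/dt = M v + g(v). One step of the scheme reads

      v' - v = M X(t) v + X(t) (theta g(v) + (1 - theta) g(v')).

    The proof shows that, for t below a threshold that depends on v alone, a
    step from a state with w(v) > 0 gives both v < v' and w(v') > 0. The second
    conclusion feeds the next step, so the theorem follows by induction, the
    thresholds being collected into a function by choice.

    The difficulty is the implicit term. Near quenching the equation for v' can
    have solutions far from v, at which g(v') is as large as 1/t, so
    it cannot be treated as a perturbation. Three facts handle it.

    - Strang splitting is of second order ([taylor2_strang]), so that
      X(t) = t I + (t^2/2) M + t^3 E(t) with E bounded. The entries of M off the
      diagonal are nonnegative ([Mxy_offdiag_ge0]), so a reaction at one point
      can lower the solution at another one only through t^3 E(t).
    - No component of v' - v exceeds 1, which forces the total reaction of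
      v' to be O(1/t) ([total_reaction_le]). Hence the harmful
      contribution t^3 E(t) g(v') is O(t^2), while the increment of v is of
      order t w(v). A component that failed to increase would have moved by
      O(t) only, and there the reaction is nearly that of v by
      semicontinuity; this is a contradiction
      ([implicit_increment_gt0]).
    - The slope at p loses at most |M p p| (v' p - v p), because all components
      increase. If that increment is small, the loss is below w(v) p; if not, it
      can only come from a reaction of size 1/t at p, which outweighs the
      loss ([slope_stays_gt0]).

    Multiplying by M^-1 is legitimate because M is invertible: 1 - x^2, constant
    in y, is a positive grid function on which M is negative ([Mxy_unit]). *)

(** * Second-order expansions of matrix functions *)

Definition bounded_mxfun (R : realType) m n (F : R -> 'M[R]_(m, n)) : Prop :=
  exists2 C : R, 0 <= C &
    forall t : R, 0 < t <= 1 -> forall i j, `|F t i j| <= C.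

(** The expansions serve for small positive time steps, hence the range ]0, 1]
    of t. *)
Definition taylor2 (R : realType) m n (F : R -> 'M[R]_(m, n))
    (A0 A1 A2 : 'M[R]_(m, n)) : Prop :=
  exists2 E : R -> 'M[R]_(m, n), bounded_mxfun E &
    forall t : R, 0 < t <= 1 ->
      F t = A0 + t *: A1 + t ^+ 2 *: A2 + t ^+ 3 *: E t.

Lemma bounded_mxfun_cst (R : realType) m n (A : 'M[R]_(m, n)) :
  bounded_mxfun (fun=> A).
Proof.
exists (\sum_i \sum_j `|A i j|).
  by apply: sumr_ge0 => i _; apply: sumr_ge0.
move=> t _ i j; rewrite (bigD1 i)//= (bigD1 j)//= -addrA lerDl addr_ge0//.
  by apply: sumr_ge0.
by apply: sumr_ge0 => k _; apply: sumr_ge0.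
Qed.

Lemma bounded_mxfunD (R : realType) m n (F G : R -> 'M[R]_(m, n)) :
  bounded_mxfun F -> bounded_mxfun G -> bounded_mxfun (fun t => F t + G t).
Proof.
move=> [C C0 FC] [D D0 GD]; exists (C + D); first exact: addr_ge0.
by move=> t t01 i j; rewrite mxE (le_trans (ler_normD _ _))// lerD ?FC ?GD.
Qed.

Lemma bounded_mxfunM (R : realType) m n p
    (F : R -> 'M[R]_(m, n)) (G : R -> 'M[R]_(n, p)) :
  bounded_mxfun F -> bounded_mxfun G -> bounded_mxfun (fun t => F t *m G t).
Proof.
move=> [C C0 FC] [D D0 GD]; exists (\sum_(k < n) C * D).
  by apply: sumr_ge0 => k _; exact: mulr_ge0.
move=> t t01 i j; rewrite mxE (le_trans (ler_norm_sum _ _ _))//.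
by apply: ler_sum => k _; rewrite normrM ler_pM ?FC ?GD.
Qed.

Lemma bounded_mxfunZ (R : realType) m n k (F : R -> 'M[R]_(m, n)) :
  bounded_mxfun F -> bounded_mxfun (fun t => t ^+ k *: F t).
Proof.
move=> [C C0 FC]; exists C => // t /[dup] t01 /andP[t0 t1] i j.
rewrite mxE normrM -[leRHS]mul1r ler_pM ?FC//.
have t0' := ltW t0.
by rewrite ger0_norm ?exprn_ge0 ?exprn_ile1.
Qed.

Lemma taylor2_bounded (R : realType) m n (F : R -> 'M[R]_(m, n)) A0 A1 A2 :
  taylor2 F A0 A1 A2 -> bounded_mxfun F.
Proof.
case=> E bE FE.
have [C C0 bC] : bounded_mxfun
    (fun t : R => t ^+ 0 *: A0 + t ^+ 1 *: A1 + t ^+ 2 *: A2 + t ^+ 3 *: E t).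
  do ?apply: bounded_mxfunD; apply: bounded_mxfunZ => //;
    exact: bounded_mxfun_cst.
exists C => // t t01 i j; have := bC t t01 i j.
by rewrite FE// expr0 expr1 scale1r.
Qed.

Lemma taylor2M (R : realType) m n p (F : R -> 'M[R]_(m, n))
    (G : R -> 'M[R]_(n, p)) A0 A1 A2 B0 B1 B2 :
  taylor2 F A0 A1 A2 -> taylor2 G B0 B1 B2 ->
  taylor2 (fun t => F t *m G t) (A0 *m B0) (A0 *m B1 + A1 *m B0)
    (A0 *m B2 + A1 *m B1 + A2 *m B0).
Proof.
move=> [E bE FE] TG; have bG := taylor2_bounded TG; case: TG => E' bE' GE'.
exists (fun t => E t *m G t
    + (A0 *m E' t + t ^+ 1 *: (A1 *m E' t) + t ^+ 2 *: (A2 *m E' t))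
    + (A1 *m B2 + A2 *m B1 + t ^+ 1 *: (A2 *m B2))).
  have bM := bounded_mxfunM; have bZ := bounded_mxfunZ.
  have bC := bounded_mxfun_cst.
  apply: bounded_mxfunD; first apply: bounded_mxfunD; [exact: bM| | ].
    by do ?[apply: bounded_mxfunD]; try apply: bZ; exact: bM.
  by do ?[apply: bounded_mxfunD]; try apply: bZ; exact: bC.
move=> t t01; rewrite FE// mulmxDl -scalemxAl.
have -> : (A0 + t *: A1 + t ^+ 2 *: A2) *m G t =
    (A0 + t *: A1 + t ^+ 2 *: A2) *m
      (B0 + t *: B1 + t ^+ 2 *: B2 + t ^+ 3 *: E' t) by rewrite GE'.
rewrite !(mulmxDl, mulmxDr, =^~ scalemxAl, =^~ scalemxAr).
apply/matrixP => i j.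
move: (A0 *m B0) (A0 *m B1) (A1 *m B0) (A0 *m B2) (A1 *m B1) (A2 *m B0)
  (A1 *m B2) (A2 *m B1) (A2 *m B2) (A0 *m E' t) (A1 *m E' t) (A2 *m E' t)
  (E t *m G t) => *.
by rewrite !mxE; ring.
Qed.

(** The sum of all the absolute values of the entries dominates every row sum,
    hence behaves as a submultiplicative norm in this induction. *)
Lemma normr_exprmx_entry (R : realType) n (A : 'M[R]_n) k i j :
  `|(A ^+ k) i j| <= (\sum_i \sum_j `|A i j|) ^+ k.
Proof.
elim: k i j => [|k IHk] i j.
  by rewrite !expr0 mxE; case: eqP => _; rewrite ?normr1 ?normr0.
rewrite !exprS mxE (le_trans (ler_norm_sum _ _ _))//.
apply: (@le_trans _ _
    (\sum_l `|A i l| * (\sum_i \sum_j `|A i j|) ^+ k)).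
  by apply: ler_sum => l _; rewrite normrM ler_pM.
have sum_ge0 (P : pred 'I_n) : 0 <= \sum_(i | P i) \sum_j `|A i j|.
  by apply: sumr_ge0 => l _; apply: sumr_ge0.
rewrite -mulr_suml ler_wpM2r ?exprn_ge0//.
by rewrite [leRHS](bigD1 i)//= lerDl.
Qed.

Lemma exprmxZ (R : realType) n (A : 'M[R]_n) (t : R) k :
  (t *: A) ^+ k = t ^+ k *: (A ^+ k).
Proof.
elim: k => [|k IHk]; first by rewrite !expr0 scale1r.
rewrite !exprS IHk -[LHS]/((t *: A) *m (t ^+ k *: A ^+ k)).
by rewrite -scalemxAl -scalemxAr scalerA.
Qed.

(** The tail of the series from the cubic term on is at most t^3 times the tail
    of the scalar series of [expR K], where K ^+ k bounds the
    entries of A ^+ k. *)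
Lemma taylor2_expmx (R : realType) n (A : 'M[R]_n) :
  taylor2 (fun t => expmx (t *: A)) 1%:M A (2^-1 *: (A *m A)).
Proof.
pose K : R := \sum_i \sum_j `|A i j|.
have K0 : 0 <= K by apply: sumr_ge0 => i _; apply: sumr_ge0.
pose P (t : R) : 'M[R]_n := 1%:M + t *: A + t ^+ 2 *: (2^-1 *: (A *m A)).
exists (fun t => t ^- 3 *: (expmx (t *: A) - P t)); last first.
  move=> t /andP[t0 _]; rewrite /= [X in _ + X]scalerA.
  rewrite mulfV ?expf_neq0 ?gt_eqF// scale1r.
  by rewrite addrC subrK.
exists (expR K); first exact: expR_ge0.
move=> t /andP[t0 t1] i j; have t0' := ltW t0.
rewrite mxE normrM normfV (ger0_norm (exprn_ge0 3 t0')) mulrC.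
rewrite ler_pdivrMr ?exprn_gt0//.
pose u k := ((t *: A) ^+ k) i j / k`!%:R : R.
have uE k : `|u k| <= t ^+ k * exp_coeff K k.
  rewrite /u exprmxZ mxE !normrM /exp_coeff/= mulrA normfV !normr_nat.
  rewrite ler_wpM2r ?invr_ge0// (ger0_norm (exprn_ge0 _ (ltW t0))).
  by rewrite ler_wpM2l ?exprn_ge0 ?(ltW t0)// normr_exprmx_entry.
have cu : cvgn (series u).
  apply: normed_cvg.
  apply: (series_le_cvg _ _ _ (is_cvg_series_exp_coeff K)) => k /=.
  - exact: normr_ge0.
  - exact: exp_coeff_ge0.
  apply: (le_trans (uE k)); rewrite ler_piMl ?exp_coeff_ge0//.
  by rewrite exprn_ile1.
have P3 : P t i j = series u 3%N.
  rewrite /series/= big_nat_recr//= big_nat_recr//= big_nat1/= /u !exprmxZ.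
  have -> : A ^+ 2 = A *m A by rewrite expr2.
  rewrite /P -[A ^+ 0]/(1%:M) expr1; move: (A *m A) (1%:M) => A2 A0.
  rewrite !mxE !factS fact0 !muln1 !divr1 expr0 mul1r; congr (_ + _).
  by rewrite mulrA mulrAC.
have key m : (3 <= m)%N -> `|series u m - series u 3| <= expR K * t ^+ 3.
  move=> m3; rewrite sub_series_geq//.
  apply: (le_trans (ler_norm_sum _ _ _)).
  apply: (@le_trans _ _ (\sum_(3 <= k < m) exp_coeff K k * t ^+ 3)).
    apply: ler_sum_nat => k /andP[k3 _].
    apply: (le_trans (uE k)); rewrite mulrC ler_wpM2l ?exp_coeff_ge0//.
    by rewrite -(subnK k3) exprD ler_piMl ?exprn_ge0 ?exprn_ile1.
  rewrite -mulr_suml ler_wpM2r ?exprn_ge0 ?(ltW t0)//.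
  apply: (@le_trans _ _ (series (exp_coeff K) m)).
    rewrite /series/= (@big_cat_nat _ _ _ 3%N 0%N m)//= lerDr.
    by apply: sumr_ge0 => k _; exact: exp_coeff_ge0.
  apply: nondecreasing_cvgn_le; last exact: is_cvg_series_exp_coeff.
  by apply: nondecreasing_series => k _ _; exact: exp_coeff_ge0.
rewrite mxE [X in _ + X]mxE [X in X - _]mxE P3 ler_distl; apply/andP; split.
  apply: limr_ge => //; near=> m.
  have /key : (3 <= m)%N by near: m; exact: nbhs_infty_ge.
  by rewrite ler_distl => /andP[].
apply: limr_le => //; near=> m.
have /key : (3 <= m)%N by near: m; exact: nbhs_infty_ge.
by rewrite ler_distl => /andP[].
Unshelve. all: by end_near. Qed.

(** The half steps with A on both sides make the quadratic terms symmetric: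
    A B and B A get the same weight 1/2, so the expansion agrees with that of
    exp (t (A + B)) up to order two even if A and B do not commute. *)
Lemma taylor2_strang (R : realType) n (A B : 'M[R]_n) :
  taylor2 (fun t => expmx ((t / 2) *: A) *m expmx (t *: B)
                      *m expmx ((t / 2) *: A))
    1%:M (A + B) (2^-1 *: ((A + B) *m (A + B))).
Proof.
have := taylor2M (taylor2M (taylor2_expmx (2^-1 *: A)) (taylor2_expmx B))
  (taylor2_expmx (2^-1 *: A)).
move=> [E bE EE]; exists E => // t t01; rewrite -!(scalerA t) EE//.
rewrite !(mulmx1, mul1mx, mulmxDl, mulmxDr, =^~ scalemxAl, =^~ scalemxAr).
apply/matrixP => i j.
move: (A *m A) (A *m B) (B *m A) (B *m B) => *; rewrite !mxE.
by field.
Qed.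

Lemma strang_quotient (R : realType) n (A B : 'M[R]_n) :
  A + B \in unitmx ->
  exists2 E : R -> 'M[R]_n, bounded_mxfun E & forall t : R, 0 < t <= 1 ->
    invmx (A + B) *m (expmx ((t / 2) *: A) *m expmx (t *: B)
                      *m expmx ((t / 2) *: A) - 1%:M)
    = t *: 1%:M + t ^+ 2 *: (2^-1 *: (A + B)) + t ^+ 3 *: E t.
Proof.
move=> uAB; have [E bE EE] := taylor2_strang A B.
exists (fun t => invmx (A + B) *m E t).
  by apply: bounded_mxfunM bE; exact: bounded_mxfun_cst.
move=> t t01; rewrite EE//; move: (A + B) uAB => M uM.
rewrite [_ - 1%:M]addrC !addrA addNr add0r.
by rewrite !mulmxDr -!scalemxAr mulVmx// mulKmx.
Qed.

(** * Invertibility of the discrete operator *)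

(** If M u = 0 with u nonzero, take p where |u p| / psi p is largest; comparing
    row p of M u = 0 with row p of M psi < 0 is contradictory, as the entries of
    row p off the diagonal are nonnegative. *)
Lemma offdiag_ge0_unitmx (R : realFieldType) n (M : 'M[R]_n) (psi : 'cV[R]_n) :
  (forall p q, p != q -> 0 <= M p q) -> (forall p, 0 < psi p 0) ->
  (forall p, (M *m psi) p 0 < 0) -> M \in unitmx.
Proof.
move=> M0 psi0 Mpsi; rewrite -unitmx_tr -row_free_unit.
apply: inj_row_free => u' u'M; pose u := u'^T.
have Mu : M *m u = 0 by rewrite -[M]trmxK -trmx_mul u'M trmx0.
suff u0 : u = 0 by rewrite -[u']trmxK -/u u0 trmx0.
apply/colP => p0; rewrite [RHS]mxE; apply/eqP; apply: contraT => up0.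
pose r p : R := `|u p 0| / psi p 0.
pose p := [arg max_(p > p0) r p]%O.
have rp q : r q <= r p.
  by rewrite /p; case: arg_maxP => // i _ le_r; exact: le_r.
have r_gt0 : 0 < r p.
  by apply: lt_le_trans (rp p0); rewrite divr_gt0 ?normr_gt0.
have ur q : `|u q 0| <= r p * psi q 0 by rewrite -ler_pdivrMr ?rp.
have upE : `|u p 0| = r p * psi p 0 by rewrite /r divfK ?gt_eqF.
have /(congr1 (fun w : 'cV_n => w p 0)) := Mu.
rewrite !mxE (bigD1 p)//= => /eqP; rewrite addr_eq0 => /eqP Epp.
have := Mpsi p; rewrite mxE (bigD1 p)//= => lt0.
have le1 : `|M p p * u p 0| <= r p * \sum_(q | q != p) M p q * psi q 0.
  rewrite Epp normrN (le_trans (ler_norm_sum _ _ _))// mulr_sumr.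
  apply: ler_sum => q qp; rewrite normrM ger0_norm ?M0 1?eq_sym//.
  by rewrite mulrCA ler_wpM2l ?M0 1?eq_sym.
have : - M p p * `|u p 0| <= `|M p p * u p 0|.
  by rewrite normrM ler_wpM2r // -normrN ler_norm.
move=> /le_trans/(_ le1); rewrite upE mulrCA ler_pM2l//.
rewrite mulNr -subr_ge0 opprK addrC => /le_lt_trans/(_ lt0).
by rewrite ltxx.
Qed.

Lemma grid_step_gt0 (R : realType) N (z : nat -> R) i :
  is_grid N z -> (i <= N)%N -> 0 < step z i.
Proof. by case=> _ _ zS iN; rewrite subr_gt0 zS. Qed.

Lemma grid_mono (R : realType) N (z : nat -> R) i j :
  is_grid N z -> (i < j)%N -> (j <= N.+1)%N -> z i < z j.
Proof.
case=> _ _ zS; elim: j => // j IHj; rewrite ltnS leq_eqVlt.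
case/orP => [/eqP ->|ij] jN; first exact: zS.
by rewrite (lt_trans (IHj ij (ltnW jN)))// zS.
Qed.

Lemma grid_interior (R : realType) N (z : nat -> R) (i : 'I_N) :
  is_grid N z -> -1 < z i.+1 < 1.
Proof.
move=> gz; have [<- <- _] := gz.
by rewrite !(grid_mono gz)//= ?ltnS// ltnW.
Qed.

Lemma Tmx_offdiag_ge0 (R : realType) N (z : nat -> R) (i j : 'I_N) :
  is_grid N z -> i != j -> 0 <= Tmx N z i j.
Proof.
move=> gz ij; rewrite mxE eq_sym (negbTE ij).
have h0 : 0 < step z i by apply: grid_step_gt0 gz _; exact: ltnW.
have h1 : 0 < step z i.+1 by exact: grid_step_gt0 gz _.
have h01 : 0 < step z i + step z i.+1 by exact: addr_gt0.
by do 2?case: ifP => _ //; rewrite ltW// divr_gt0// mulr_gt0.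
Qed.

Lemma sum_ord_pred1 (R : pzSemiRingType) N m (F : nat -> R) :
  \sum_(j < N) ((j == m :> nat)%:R * F j) = if (m < N)%N then F m else 0.
Proof.
case: ifP => mN.
  rewrite (bigD1 (Ordinal mN))//= eqxx mul1r big1 ?addr0// => j.
  by rewrite -val_eqE/= => /negbTE ->; rewrite mul0r.
rewrite big1// => j _; case: eqP => [jm|_]; last by rewrite mul0r.
by rewrite -jm ltn_ord in mN.
Qed.

(** The right-hand side is the full three-point second difference. The matrix
    drops the terms that fall on the boundary points 0 and N.+1, which can only
    decrease the sum as [u] is nonnegative there. *)
Lemma Tmx_sum_le (R : realType) N (z : nat -> R) (u : nat -> R) (i : 'I_N) :
  is_grid N z -> 0 <= u 0 -> 0 <= u N.+1 ->
  \sum_(j < N) Tmx N z i j * u j.+1 <=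
    - (2 / (step z i * step z i.+1)) * u i.+1
    + 2 / (step z i.+1 * (step z i + step z i.+1)) * u i.+2
    + 2 / (step z i * (step z i + step z i.+1)) * u i.
Proof.
move=> gz u0 uN.
have h0 : 0 < step z i by apply: grid_step_gt0 gz _; exact: ltnW.
have h1 : 0 < step z i.+1 by exact: grid_step_gt0 gz _.
have h01 : 0 < step z i + step z i.+1 by exact: addr_gt0.
set d := - _; set r := 2 / _; set l := 2 / _.
have r0 : 0 <= r by rewrite divr_ge0 ?mulr_ge0 ?(ltW h0, ltW h1, ltW h01).
have l0 : 0 <= l by rewrite divr_ge0 ?mulr_ge0 ?(ltW h0, ltW h1, ltW h01).
under eq_bigr => j _.
  have -> : Tmx N z i j * u j.+1 =
      d * ((j == i :> nat)%:R * u j.+1) + r * ((j == i.+1 :> nat)%:R * u j.+1)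
      + l * ((j.+1 == i :> nat)%:R * u j.+1).
    rewrite mxE -/d -/r -/l (eq_sym (j.+1)) -val_eqE/=.
    case: eqP => [->|_].
      by rewrite (ltn_eqF (ltnSn i)) mul1r !mul0r !mulr0 !addr0.
    case: eqP => [->|_].
      by rewrite (ltn_eqF (leqnSn i.+1)) mul1r !mul0r !mulr0 addr0 add0r.
    by case: eqP => _; rewrite ?mul1r !mul0r !mulr0 !add0r.
  over.
rewrite !big_split/= -!mulr_sumr.
rewrite (sum_ord_pred1 _ i (fun j => u j.+1)) ltn_ord.
rewrite (sum_ord_pred1 _ i.+1 (fun j => u j.+1)).
have le_r : r * (if (i.+1 < N)%N then u i.+2 else 0) <= r * u i.+2.
  rewrite ler_wpM2l//; case: ltnP => // Ni.
  by have -> : i.+1 = N by apply/eqP; rewrite eqn_leq Ni ltn_ord.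
suff le_l : l * (\sum_(j < N) (j.+1 == i :> nat)%:R * u j.+1) <= l * u i.
  by rewrite lerD// lerD.
rewrite ler_wpM2l//; case: (i : nat) (ltn_ord i) => [|k] kN.
  by rewrite big1// => j _; rewrite mul0r.
by rewrite (sum_ord_pred1 _ k (fun j => u j.+1)) (ltnW kN).
Qed.

Lemma Tmx_const_le0 (R : realType) N (z : nat -> R) (i : 'I_N) :
  is_grid N z -> (Tmx N z *m const_mx 1) i (0 : 'I_1) <= 0.
Proof.
move=> gz; rewrite mxE.
have h0 : 0 < step z i by apply: grid_step_gt0 gz _; exact: ltnW.
have h1 : 0 < step z i.+1 by exact: grid_step_gt0 gz _.
under eq_bigr do rewrite [X in _ * X]mxE.
apply: (le_trans (Tmx_sum_le (u := fun=> 1) i gz ler01 ler01)).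
move: h0 h1; move: (step z i) (step z i.+1) => h k h0 k0.
rewrite !mulr1 le_eqVlt; apply/orP; left; apply/eqP; field.
by rewrite !gt_eqF// addr_gt0.
Qed.

(** The second difference is exact on quadratic polynomials, whatever the steps,
    and 1 - z^2 vanishes at both ends of the grid: the value is -2. *)
Lemma Tmx_barrier_lt0 (R : realType) N (z : nat -> R) (i : 'I_N) :
  is_grid N z -> (Tmx N z *m \col_j (1 - z j.+1 ^+ 2)) i (0 : 'I_1) < 0.
Proof.
move=> gz; rewrite mxE.
have h0 : 0 < step z i by apply: grid_step_gt0 gz _; exact: ltnW.
have h1 : 0 < step z i.+1 by exact: grid_step_gt0 gz _.
under eq_bigr do rewrite [X in _ * X]mxE.
have [z0 zN _] := gz.
apply: (@le_lt_trans _ _ (- 2)); last by rewrite oppr_lt0.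
apply: (le_trans (Tmx_sum_le (u := fun j => 1 - z j ^+ 2) i gz _ _)).
- by rewrite z0 sqrrN expr1n subrr.
- by rewrite zN expr1n subrr.
have -> : z i.+2 = z i + step z i + step z i.+1.
  by rewrite /step; ring.
have -> : z i.+1 = z i + step z i by rewrite /step; ring.
move: h0 h1; move: (step z i) (step z i.+1) (z i) => h k s h0 k0.
rewrite le_eqVlt; apply/orP; left; apply/eqP; field.
by rewrite !gt_eqF// addr_gt0.
Qed.

Lemma square_grid_pt (R : realType) Nx Ny (x y : nat -> R) (p : 'I_(Ny * Nx)) :
  is_grid Nx x -> is_grid Ny y -> square (grid_pt x y p).
Proof.
move=> gx gy; split; rewrite /= in_itv/=.
  exact: (grid_interior (mxtens_unindex p).2 gx).
exact: (grid_interior (mxtens_unindex p).1 gy).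
Qed.

Lemma degeneracy_gt0 (R : realType) (sigma : R * R -> R) p :
  is_degeneracy sigma -> square p -> 0 < sigma p.
Proof.
move=> [sigma0 sigmaZ] sp.
have cp := @topology_structure.subset_closure _ (@square R) _ sp.
rewrite lt_neqAle sigma0// andbT eq_sym; apply/eqP => sp0.
have [_ []] := sigmaZ p (conj cp sp0).
case: sp => /= sp1 sp2; exists (`]-1, 1[%classic, `]-1, 1[%classic) => //=.
by split; apply: open_nbhs_nbhs; split => //; exact: itv_open.
Qed.

Lemma MxyE (R : realType) Nx Ny (a b : R) (x y : nat -> R)
    (sigma : R * R -> R) p q :
  Mxy Nx Ny a b x y sigma p q =
    (sigma (grid_pt x y p))^-1 *
    (a ^- 2 * tensmx (1%:M : 'M[R]_Ny) (Tmx Nx x) p q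
     + b ^- 2 * tensmx (Tmx Ny y) (1%:M : 'M[R]_Nx) p q).
Proof.
rewrite /Mxy /Mx /My /Bmx !mul_diag_mx.
by move: (tensmx _ _) (tensmx _ _) => U V; rewrite !mxE; ring.
Qed.

Lemma Mxy_offdiag_ge0 (R : realType) Nx Ny (a b : R) (x y : nat -> R)
    (sigma : R * R -> R) p q :
  0 < a -> 0 < b -> is_grid Nx x -> is_grid Ny y -> is_degeneracy sigma ->
  p != q -> 0 <= Mxy Nx Ny a b x y sigma p q.
Proof.
move=> a0 b0 gx gy dsigma pq; rewrite MxyE.
have s0 := degeneracy_gt0 dsigma (square_grid_pt p gx gy).
rewrite mulr_ge0 ?invr_ge0 ?(ltW s0)//.
case: (mxtens_indexP p) pq => j i; case: (mxtens_indexP q) => l k pq.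
rewrite !tensmxE ![1%:M _ _]mxE.
have [jl|jl] := eqVneq j l; have [ik|ik] := eqVneq i k.
- by rewrite jl ik eqxx in pq.
- rewrite mulr1n mulr0n mul1r mulr0 mulr0 addr0.
  by rewrite mulr_ge0 ?invr_ge0 ?exprn_ge0 ?Tmx_offdiag_ge0// ltW.
- rewrite mulr1n mulr0n mul0r mulr1 mulr0 add0r.
  by rewrite mulr_ge0 ?invr_ge0 ?exprn_ge0 ?Tmx_offdiag_ge0// ltW.
- by rewrite !mulr0n mul0r !mulr0 addr0.
Qed.

(** The barrier is the tensor product of 1 in y with 1 - x^2 in x. The
    x-part of M is negative on it and the y-part nonpositive. *)
Lemma Mxy_unit (R : realType) Nx Ny (a b : R) (x y : nat -> R)
    (sigma : R * R -> R) :
  0 < a -> 0 < b -> is_grid Nx x -> is_grid Ny y -> is_degeneracy sigma ->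
  Mxy Nx Ny a b x y sigma \in unitmx.
Proof.
move=> a0 b0 gx gy dsigma.
pose phi : 'cV[R]_Nx := \col_i (1 - x i.+1 ^+ 2).
pose one : 'cV[R]_Ny := const_mx 1.
have phi0 i : 0 < phi i 0.
  have /andP[lo hi] := grid_interior i gx.
  by rewrite mxE subr_gt0; nra.
apply: (@offdiag_ge0_unitmx _ _ _ (tensmx one phi : 'cV_(Ny * Nx))).
- by move=> p q pq; exact: Mxy_offdiag_ge0.
- by move=> p; rewrite mxE [X in X * _]mxE mul1r [X in phi _ X]ord1.
move=> p.
have -> : (Mxy Nx Ny a b x y sigma *m (tensmx one phi : 'cV_(Ny * Nx))) p 0
    = (sigma (grid_pt x y p))^-1 *
      (a ^- 2 * tensmx one (Tmx Nx x *m phi) p 0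
       + b ^- 2 * tensmx (Tmx Ny y *m one) phi p 0).
  have E1 := tensmx_mul (1%:M : 'M[R]_Ny) (Tmx Nx x) one phi.
  have E2 := tensmx_mul (Tmx Ny y) (1%:M : 'M[R]_Nx) one phi.
  rewrite !mul1mx in E1 E2; rewrite -E1 -E2 [LHS]mxE.
  rewrite [X in a ^- 2 * X]mxE [X in b ^- 2 * X]mxE !mulr_sumr -big_split/=.
  rewrite mulr_sumr; apply: eq_bigr => q _.
  by rewrite MxyE; ring.
have s0 := degeneracy_gt0 dsigma (square_grid_pt p gx gy).
rewrite pmulr_rlt0 ?invr_gt0//.
case: (mxtens_indexP p) => j i.
have T1 := Tmx_barrier_lt0 i gx; have T2 := Tmx_const_le0 j gy.
rewrite -/phi in T1; rewrite -/one in T2.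
move: (Tmx Nx x *m phi) T1 (Tmx Ny y *m one) T2 => u u0 w w0.
rewrite (mxE _ _ (mxtens_index _)) [X in _ + _ * X]mxE !mxtens_indexK/=.
rewrite mxE mul1r [X in u _ X]ord1 [X in w _ X]ord1 [X in phi _ X]ord1.
have a2 : 0 < a ^- 2 by rewrite invr_gt0 exprn_gt0.
have b2 : 0 < b ^- 2 by rewrite invr_gt0 exprn_gt0.
rewrite -[ltRHS]addr0 ltr_leD ?pmulr_rlt0//.
by rewrite pmulr_rle0// mulr_le0_ge0// ltW.
Qed.

(** * Monotonicity and semicontinuity of the reaction *)

(** At 0 only a one-sided derivative is given; as it is positive, phi 0 lies
    below phi h for small h, and the interior estimate applies from h on. *)
Lemma source_nondecreasing (R : realType) (phi : R -> R) u w :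
  is_source phi -> 0 <= u -> u <= w -> w < 1 -> phi u <= phi w.
Proof.
move=> [dphi [l l0 phil] _ _ _].
have phi_oo s t : 0 < s -> s <= t -> t < 1 -> phi s <= phi t.
  move=> s0 st t1.
  apply: (@ger0_derive1_le_oo _ phi 0 1) => //.
  - by move=> r; rewrite in_itv/= => /dphi[].
  - by move=> r; rewrite in_itv/= => /dphi[_ /ltW].
  - move=> r; rewrite inE/= in_itv/= => /dphi[dr _].
    by apply: differentiable_continuous; apply/derivable1_diffP.
  - by rewrite in_itv/= s0 (le_lt_trans st).
  - by rewrite in_itv/= t1 (lt_le_trans s0).
rewrite le_eqVlt => /orP[/eqP <-|u0] uw w1; last exact: phi_oo.
move: uw; rewrite le_eqVlt => /orP[/eqP <-//|w0].
near (at_right (0 : R)) => h.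
have h0 : 0 < h by near: h; exact: nbhs_right_gt.
have hw : h <= w by near: h; exact: nbhs_right_le.
apply: le_trans (phi_oo _ _ h0 hw w1).
have : 0 < h^-1 * (phi h - phi 0) by near: h; exact: (cvgr_gt l).
by rewrite pmulr_rgt0 ?invr_gt0// subr_gt0 => /ltW.
Unshelve. all: by end_near. Qed.

(** To the left of an interior point this is continuity; to the right, and at
    0, it is monotonicity. *)
Lemma source_lower_semicontinuous (R : realType) (phi : R -> R) u e :
  is_source phi -> 0 <= u < 1 -> 0 < e ->
  exists2 h, 0 < h & forall w, 0 <= w < 1 -> u - h < w -> phi u - e < phi w.
Proof.
move=> sphi /andP[]; rewrite le_eqVlt => /orP[/eqP <- _|u0 u1] e0.
  exists 1 => // w /andP[w0 w1] _; apply: (@lt_le_trans _ _ (phi 0)).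
    by rewrite ltrBlDr ltrDl.
  exact: source_nondecreasing sphi (lexx _) w0 w1.
have [dphi _ _ _ _] := sphi.
have /derivable1_diffP/differentiable_continuous cu : derivable phi u 1.
  by have [|] := dphi u; rewrite ?u0.
have /cvgrPdist_lt/(_ e e0)/nbhs_ballP[h h0 Hh] := cu.
exists h => // w /andP[w0 w1] uw.
have [le_uw|lt_wu] := leP u w.
  apply: (@lt_le_trans _ _ (phi u)); first by rewrite ltrBlDr ltrDl.
  by apply: source_nondecreasing sphi _ le_uw w1; exact: ltW.
have /Hh/= : ball u h w.
  by rewrite /ball/= ger0_norm ?subr_ge0 ?ltW// ltrBlDr addrC -ltrBlDr.
by rewrite ltr_distlC => /andP[] + _; rewrite ltrBlDr.
Qed.

(** * One implicit step with an abstract reaction *)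

(** Here [b] and [H] stand for the explicit and the implicit reaction.
    The constant C is uniform in H >= 0, because H may be as large as
    1/t. In the lower bound the total of H occurs only with a factor t^3, since
    at order t^2 the other components act on q through the nonnegative entries
    of M off the diagonal; only H q itself is diminished at that order, through
    the diagonal of M. *)
Lemma increment_bounds (R : realType) n (M : 'M[R]_n) (X E : R -> 'M[R]_n)
    (v b : 'cV[R]_n) :
  (forall p q, p != q -> 0 <= M p q) -> bounded_mxfun E ->
  (forall t : R, 0 < t <= 1 ->
     X t = t *: 1%:M + t ^+ 2 *: (2^-1 *: M) + t ^+ 3 *: E t) ->
  exists2 C : R, 0 <= C & forall t : R, 0 < t <= 1 -> forall H : 'cV[R]_n,
    (forall p, 0 <= H p 0) -> forall q,
    let c := (M *m v + b) q 0 in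
    let d := (M *m (X t *m v) + X t *m (b + H)) q 0 in
    let S := \sum_p H p 0 in
    t * c + t * (1 - C * t) * H q 0 - C * t ^+ 2 * (1 + t * S) <= d
      <= t * c + t * H q 0 + C * t ^+ 2 * (1 + S).
Proof.
move=> M0 bE XE.
pose r (t : R) : 'cV[R]_n := 2^-1 *: (M *m (M *m v) + M *m b)
   + t ^+ 1 *: (M *m E t *m v + E t *m b).
have [C1 C10 r_le] : bounded_mxfun r.
  have bC := bounded_mxfun_cst; apply: bounded_mxfunD; first exact: bC.
  apply/bounded_mxfunZ/bounded_mxfunD; apply: bounded_mxfunM (bC _ _ _ _) => //.
  exact: bounded_mxfunM (bC _ _ _ _) bE.
have [C2 C20 E_le] := bE.
have [K K0 M_le] := bounded_mxfun_cst M.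
exists (C1 + K + C2); first by rewrite !addr_ge0.
move=> t /[dup] t01 /andP[t0 t1] H H0 q; cbv zeta.
set c := (_ + b) q 0; set d := (_ + _ *m (b + H)) q 0; set S := \sum_p _.
have S0 : 0 <= S by exact: sumr_ge0.
have dE : d = t * c + t ^+ 2 * r t q 0 + t * H q 0
    + t ^+ 2 * (2^-1 * (M *m H) q 0) + t ^+ 3 * (E t *m H) q 0.
  rewrite /d /c /r XE//.
  rewrite !(mulmxDl, mulmxDr, =^~ scalemxAl, =^~ scalemxAr).
  rewrite !(mul1mx, mulmx1, mulmxA).
  move: (M *m M *m v) (M *m v) (M *m b) (M *m E t *m v) (E t *m b) (M *m H)
    (E t *m H) => *; rewrite !mxE.
  by ring.
have /ler_normlP[rlo rhi] := r_le t t01 q 0.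
have /ler_normlP[Elo Ehi] : `|(E t *m H) q 0| <= C2 * S.
  rewrite mxE (le_trans (ler_norm_sum _ _ _))// mulr_sumr.
  apply: ler_sum => p _; rewrite normrM (ger0_norm (H0 p)).
  by rewrite ler_wpM2r// E_le.
have MK p : `|M q p| <= K by apply: (M_le 1); rewrite ltr01 lexx.
have Mhi : (M *m H) q 0 <= K * S.
  rewrite mxE mulr_sumr; apply: ler_sum => p _; rewrite ler_wpM2r//.
  exact: le_trans (ler_norm _) (MK p).
have Mlo : - (K * H q 0) <= (M *m H) q 0.
  rewrite mxE (bigD1 q)//= -mulNr -[leLHS]addr0 lerD//.
    by rewrite ler_wpM2r// lerNl (le_trans _ (MK q))// -normrN ler_norm.
  by apply: sumr_ge0 => p pq; rewrite mulr_ge0// M0// eq_sym.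
rewrite dE; move: (r t q 0) ((M *m H) q 0) ((E t *m H) q 0) (H q 0) (H0 q)
  rlo rhi Elo Ehi Mlo Mhi => rq mq eq Hq Hq0 rlo rhi elo ehi mlo mhi.
have t20 : 0 <= t ^+ 2 by rewrite exprn_ge0// ltW.
have t30 : 0 <= t ^+ 3 by rewrite exprn_ge0// ltW.
have t32 : t ^+ 3 <= t ^+ 2 by rewrite exprSr ler_piMr.
have rlo' : t ^+ 2 * - C1 <= t ^+ 2 * rq by rewrite ler_wpM2l// lerNl.
have rhi' : t ^+ 2 * rq <= t ^+ 2 * C1 by rewrite ler_wpM2l.
have elo' : t ^+ 3 * - (C2 * S) <= t ^+ 3 * eq by rewrite ler_wpM2l// lerNl.
have ehi' : t ^+ 3 * eq <= t ^+ 3 * (C2 * S) by rewrite ler_wpM2l.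
have ehi2 : t ^+ 3 * (C2 * S) <= t ^+ 2 * (C2 * S).
  by rewrite ler_wpM2r// mulr_ge0.
have mlo' : t ^+ 2 * (2^-1 * - (K * Hq)) <= t ^+ 2 * (2^-1 * mq).
  by rewrite ler_wpM2l// ler_wpM2l// invr_ge0.
have mhi' : t ^+ 2 * (2^-1 * mq) <= t ^+ 2 * (2^-1 * (K * S)).
  by rewrite ler_wpM2l// ler_wpM2l// invr_ge0.
have nn (x y : R) : 0 <= x -> 0 <= y -> 0 <= t ^+ 2 * (x * y).
  by move=> *; rewrite mulr_ge0// mulr_ge0.
have := (nn _ _ C10 Hq0, nn _ _ K0 Hq0, nn _ _ C20 Hq0, nn _ _ C10 S0,
         nn _ _ K0 S0, nn _ _ K0 ler01, nn _ _ C20 ler01).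
move=> [[[[[[]]]]]] ? ? ? ? ? ? ?.
have nn3 : 0 <= t ^+ 3 * ((C1 + K) * S).
  by rewrite mulr_ge0// mulr_ge0// addr_ge0.
by apply/andP; split; lra.
Qed.

Lemma near0_mulr_lt (R : realType) (K e : R) :
  0 < e -> \forall t \near at_right 0, t * K < e.
Proof.
move=> e0; have K1 : 0 < `|K| + 1 by rewrite ltr_wpDl.
near=> t; have t0 : 0 < t by near: t; exact: nbhs_right_gt.
apply: (@le_lt_trans _ _ (t * (`|K| + 1))).
  by rewrite ler_pM2l// (le_trans (ler_norm _))// lerDl.
rewrite -ltr_pdivlMr//; near: t; apply: nbhs_right_lt; exact: divr_gt0.
Unshelve. all: by end_near. Qed.

(** Summed over q, the lower bounds control the total of H from above, and the
    sum of the d q is at most n. *)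
Lemma total_reaction_le (R : realFieldType) n (C t : R) (c H d : 'I_n -> R) :
  0 <= C -> 0 < t <= 1 -> t * (2 * C * (1 + n%:R)) < 1 ->
  (forall q, 0 <= H q) -> (forall q, d q <= 1) ->
  (forall q, t * c q + t * (1 - C * t) * H q
             - C * t ^+ 2 * (1 + t * \sum_p H p) <= d q) ->
  t * \sum_p H p <= 2 * (n%:R + \sum_q `|c q| + n%:R * C).
Proof.
move=> C0 /andP[t0 t1] tC H0 d1 dlo; set S := \sum_p _; set A := \sum_q `|_|.
have tS0 : 0 <= t * S by rewrite mulr_ge0 ?sumr_ge0// ltW.
have n0 : 0 <= n%:R :> R by exact: ler0n.
have t2t : t ^+ 2 <= t by rewrite expr2 ler_piMr// ltW.
have : \sum_q (t * c q + t * (1 - C * t) * H q - C * t ^+ 2 * (1 + t * S))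
    <= \sum_(q < n) 1.
  by apply: ler_sum => q _; apply: le_trans (d1 q).
rewrite !big_split/= -!mulr_sumr -/S !sumr_const card_ord.
rewrite -[(- _) *+ n]mulr_natl => sum_le.
have tA : - A <= t * \sum_q c q.
  rewrite lerNl -mulrN -sumrN (le_trans (y := t * A))//; last first.
    by rewrite ler_piMl// sumr_ge0.
  by rewrite ler_pM2l//; apply: ler_sum => q _; rewrite -normrN ler_norm.
have nCt2 : n%:R * (C * t ^+ 2) <= n%:R * (C * t).
  by rewrite ler_wpM2l// ler_wpM2l.
have nCt : n%:R * (C * t) <= n%:R * C by rewrite ler_wpM2l// ler_piMr.
have half : 2^-1 * (t * S) <= (1 - C * t - n%:R * (C * t ^+ 2)) * (t * S).
  apply: ler_wpM2r => //; clear -tC nCt2; lra.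
clear -sum_le tA half nCt nCt2; lra.
Qed.

(** One component: m = (M v) q, g and g' are the reactions at v and v', and
    m + g is the slope. If d were nonpositive, g' would lie at most half
    the slope below g, so the bracket in the lower bound would be at least half
    the slope minus t (D + C g), which is positive. *)
Lemma implicit_increment_gt0 (R : realFieldType) (th t C D m g g' d : R) :
  0 <= th <= 1 -> 0 < t -> 0 <= C * t -> 0 <= g -> 0 < m + g ->
  t * (D + C * g) < (m + g) / 2 ->
  (d <= 0 -> g - (m + g) / 2 < g' <= g) ->
  t * (m + th * g + (1 - C * t) * ((1 - th) * g') - D * t) <= d -> 0 < d.
Proof.
move=> /andP[th0 th1] t0 Ct0 g0 mg small near_g lo.
rewrite ltNge; apply/negP => d0; have /andP[g'lo g'hi] := near_g d0.
have lo0 : m + th * g + (1 - C * t) * ((1 - th) * g') - D * t <= 0.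
  by rewrite -(pmulr_rle0 _ t0) (le_trans lo).
have th1' : 0 <= 1 - th by rewrite subr_ge0.
have e1 : (1 - th) * (g - (m + g) / 2) <= (1 - th) * g'.
  by rewrite ler_wpM2l// ltW.
have e2 : (1 - th) * g' <= (1 - th) * g by rewrite ler_wpM2l.
have thg : 0 <= th * g by rewrite mulr_ge0.
have e3 : C * t * ((1 - th) * g') <= C * t * g by rewrite ler_wpM2l//; lra.
have e4 : 0 <= th * (m + g) by rewrite mulr_ge0// ltW.
lra.
Qed.

(** One component: H is the implicit part of the reaction g' at v', and Md the
    change of M v. Either d is small and Md is at least minus half the
    slope, or d is not and then H, of order d / t, exceeds K + g. *)
Lemma slope_stays_gt0 (R : realFieldType) (K L t m Md g g' H d : R) :
  0 <= K -> 0 < t -> 0 < m + g -> g <= g' -> H <= g' -> 0 < d <= 1 ->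
  - (K * d) <= Md -> d <= t * (H + L) ->
  t * (K + g + L) < (m + g) / (2 * (K + 1)) -> 0 < m + Md + g'.
Proof.
move=> K0 t0 mg gg' Hg' /andP[d0 d1] MdK dH small.
have K1 : 0 < 2 * (K + 1) by rewrite mulr_gt0// ltr_wpDl.
have [d_small|d_large] := ltP d ((m + g) / (2 * (K + 1))).
  move: d_small; rewrite ltr_pdivlMr// => d_small.
  have : 0 <= K * d by rewrite mulr_ge0// ltW.
  by clear -d_small MdK gg' d0; lra.
have : t * (K + g + L) < t * (H + L).
  exact: lt_le_trans small (le_trans d_large dH).
rewrite ltr_pM2l// => KgH.
have Kd : K * d <= K by rewrite ler_piMr.
lra.
Qed.

(** The threshold on t depends on v, through the reaction, the slope and the
    modulus of semicontinuity at v, but not on v'. *)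
Lemma implicit_step_increasing (R : realType) n (M : 'M[R]_n)
    (X E : R -> 'M[R]_n) (G : 'I_n -> R -> R) (theta : R) (v : 'cV[R]_n) :
  (forall p q, p != q -> 0 <= M p q) -> bounded_mxfun E ->
  (forall t : R, 0 < t <= 1 ->
     X t = t *: 1%:M + t ^+ 2 *: (2^-1 *: M) + t ^+ 3 *: E t) ->
  (forall p, 0 <= G p 0) ->
  (forall p u w, 0 <= u -> u <= w -> w < 1 -> G p u <= G p w) ->
  (forall p u e, 0 <= u < 1 -> 0 < e -> exists2 h, 0 < h &
     forall w, 0 <= w < 1 -> u - h < w -> G p u - e < G p w) ->
  0 <= theta <= 1 -> in01 v ->
  (forall p, 0 < (M *m v) p 0 + G p (v p 0)) ->
  \forall t \near at_right (0 : R), forall v' : 'cV[R]_n, in01 v' ->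
    v' - v = M *m (X t *m v)
      + X t *m (theta *: (\col_p G p (v p 0))
                + (1 - theta) *: (\col_p G p (v' p 0))) ->
    ltcv v v' /\ forall p, 0 < (M *m v') p 0 + G p (v' p 0).
Proof.
move=> M0 bE XE G0 Gmono Glsc /andP[th0 th1] v01 w_gt0.
pose b : 'cV[R]_n := theta *: \col_p G p (v p 0).
have [C C0 dle] := increment_bounds v b M0 bE XE.
have [K K0 M_le] := bounded_mxfun_cst M.
pose c q := (M *m v + b) q 0.
pose g q := G q (v q 0).
pose w q := (M *m v) q 0 + g q.
pose A := \sum_q `|c q|.
have A0 : 0 <= A by exact: sumr_ge0.
have c_le q : `|c q| <= A by rewrite /A (bigD1 q)//= lerDl sumr_ge0.
(* B bounds t times the total implicit reaction; C' t^2 is then the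
   error in the lower bound on an increment, and t L bounds how far a
   component can decrease. *)
pose B := 2 * (n%:R + A + n%:R * C).
pose C' := C * (1 + B).
pose L := A + C' + 1.
have n0 : 0 <= n%:R :> R by exact: ler0n.
have B0 : 0 <= B by rewrite mulr_ge0// !addr_ge0// mulr_ge0.
have C'0 : 0 <= C' by rewrite mulr_ge0// addr_ge0.
have G_ge0 p u : 0 <= u < 1 -> 0 <= G p u.
  by move=> /andP[u0 u1]; apply: le_trans (G0 p) (Gmono _ _ _ _ _ _).
near=> t => v' v'01 dE.
have t0 : 0 < t by near: t; exact: nbhs_right_gt.
have t1 : t <= 1 by near: t; exact: nbhs_right_le.
have tC : t * (2 * C * (1 + n%:R)) < 1 by near: t; exact: near0_mulr_lt.
have tlsc : forall q x, 0 <= x < 1 -> v q 0 - t * L < x ->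
    g q - w q / 2 < G q x.
  near: t; apply: filter_forall => q.
  have [|h h0 Hh] := Glsc q _ (w q / 2) (v01 q).
    by rewrite divr_gt0// w_gt0.
  apply: filterS (near0_mulr_lt L h0) => s sL x x01 sx.
  by apply: Hh => //; apply: le_lt_trans sx; rewrite lerB// ltW.
have tw : forall q, t * (C' + C * g q) < w q / 2.
  near: t; apply: filter_forall => q; apply: near0_mulr_lt.
  by rewrite divr_gt0// w_gt0.
have tK : forall q, t * (K + g q + L) < w q / (2 * (K + 1)).
  near: t; apply: filter_forall => q; apply: near0_mulr_lt.
  by rewrite divr_gt0 ?w_gt0// mulr_gt0// ltr_wpDl.
have t01 : 0 < t <= 1 by rewrite t0.
pose H : 'cV[R]_n := (1 - theta) *: \col_p G p (v' p 0).
have HE q : H q 0 = (1 - theta) * G q (v' q 0) by rewrite !mxE.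
have cE q : c q = (M *m v) q 0 + theta * g q.
  by rewrite /c mxE [b q 0]mxE [X in _ * X]mxE.
have H0 q : 0 <= H q 0 by rewrite HE mulr_ge0 ?subr_ge0 ?G_ge0.
pose d q := v' q 0 - v q 0.
have dqE q : d q = (M *m (X t *m v) + X t *m (b + H)) q 0 by rewrite -dE !mxE.
have d_le1 q : d q <= 1.
  have := v01 q; have := v'01 q; rewrite /d.
  by clear => /andP[? ?] /andP[? ?]; lra.
have := dle t t01 H H0; cbv zeta; set S := \sum_p _ => dbnd.
have tS_le : t * S <= B.
  apply: total_reaction_le (d_le1) _ => // q.
  by rewrite dqE; have /andP[] := dbnd q.
have Ct0 : 0 <= C * t by rewrite mulr_ge0// ltW.
have Ct2 : 0 <= C * t ^+ 2 by rewrite mulr_ge0// exprn_ge0// ltW.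
have Ct2t : C * t ^+ 2 <= C * t by rewrite ler_wpM2l// expr2 ler_piMr// ltW.
have CtS : C * t ^+ 2 * (t * S) <= C * t ^+ 2 * B by rewrite ler_wpM2l.
have CtS' : C * t * (t * S) <= C * t * B by rewrite ler_wpM2l.
have d_lo q : t * (c q + (1 - C * t) * H q 0 - C' * t) <= d q.
  have /andP[lo _] := dbnd q; rewrite dqE; apply: le_trans lo.
  by rewrite -/(c q) /C'; clear -CtS; lra.
have d_hi q : d q <= t * (H q 0 + L).
  have /andP[_ hi] := dbnd q; rewrite dqE; apply: (le_trans hi).
  have : t * c q <= t * A by rewrite ler_pM2l// (le_trans (ler_norm _)).
  by rewrite -/(c q) /L /C'; clear -CtS' Ct2t t0 C0; lra.
have Ct1 : C * t <= 1.
  have : 0 <= C * t * n%:R by rewrite mulr_ge0.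
  by clear -tC Ct0; lra.
have d_lower q : - (t * L) < d q.
  apply: lt_le_trans (d_lo q); rewrite -mulrN ltr_pM2l//.
  have : 0 <= (1 - C * t) * H q 0 by rewrite mulr_ge0// subr_ge0.
  have : C' * t <= C' by rewrite ler_piMr.
  have := c_le q; rewrite ler_norml => /andP[cq _].
  by rewrite /L; clear -cq; lra.
have d_gt0 q : 0 < d q.
  have /andP[v0 v1] := v01 q; have /andP[v'0 _] := v'01 q.
  apply: (@implicit_increment_gt0 _ theta t C C' ((M *m v) q 0) (g q)
    (G q (v' q 0))); rewrite ?th0//.
  - exact: G_ge0.
  - rewrite subr_le0 => v'v; rewrite Gmono// andbT; apply: tlsc => //.
    by rewrite addrC -ltrBrDr; exact: d_lower.
  - by rewrite -cE -HE; exact: d_lo.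
split=> [q|p]; first by rewrite -subr_gt0 d_gt0.
have MvE : (M *m v') p 0 = (M *m v) p 0 + \sum_q M p q * d q.
  rewrite !mxE -big_split/=; apply: eq_bigr => q _.
  by rewrite /d; ring.
have /andP[v0 _] := v01 p; have /andP[_ v'1] := v'01 p.
rewrite MvE; apply: slope_stays_gt0 (K0) t0 (w_gt0 p) _ _ _ _ (d_hi p) (tK p).
- by apply: Gmono => //; rewrite ltW// -subr_gt0 d_gt0.
- by rewrite HE ler_piMl ?G_ge0// lerBlDr lerDl.
- by rewrite d_gt0 d_le1.
rewrite (bigD1 p)//= -mulNr -[leLHS]addr0 lerD//.
  rewrite ler_wpM2r ?(ltW (d_gt0 p))// lerNl.
  by rewrite (le_trans (ler_norm _))// normrN (M_le 1)// ltr01 lexx.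
by apply: sumr_ge0 => q qp; rewrite mulr_ge0 ?(ltW (d_gt0 q))// M0// eq_sym.
Unshelve. all: by end_near. Qed.

(** * Monotonicity of the computed solution *)

Lemma scheme_step_increasing (R : realType) (Nx Ny : nat) (a b : R)
    (x y : nat -> R) (sigma : R * R -> R) (eps : R * R -> R) (f : R -> R -> R)
    (theta : R) (v : 'cV[R]_(Ny * Nx)) :
  let slope u := Mxy Nx Ny a b x y sigma *m u + gvec x y sigma eps f u in
  0 < a -> 0 < b -> is_grid Nx x -> is_grid Ny y ->
  is_degeneracy sigma -> is_reaction eps f -> 0 <= theta <= 1 ->
  in01 v -> ltcv 0 (slope v) ->
  exists2 t0 : R, 0 < t0 & forall t v', 0 < t <= t0 -> in01 v' ->
    scheme_step a b x y sigma eps f theta t v v' ->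
    ltcv v v' /\ ltcv 0 (slope v').
Proof.
move=> slope ha hb hx hy hsigma hf htheta v01 wv.
pose M := Mxy Nx Ny a b x y sigma.
pose g := gvec (Nx := Nx) (Ny := Ny) x y sigma eps f.
pose G (p : 'I_(Ny * Nx)) u :=
  f (eps (grid_pt x y p)) u / sigma (grid_pt x y p).
have gE u : g u = \col_p G p (u p 0) by [].
have s0 (p : 'I_(Ny * Nx)) : 0 < sigma (grid_pt x y p).
  exact: degeneracy_gt0 hsigma (square_grid_pt p hx hy).
have src (p : 'I_(Ny * Nx)) : is_source (f (eps (grid_pt x y p))).
  by case: hf => _ + _; apply; exact: square_grid_pt.
have uM := Mxy_unit ha hb hx hy hsigma.
have [E bE XE] := strang_quotient uM.
have G0 p : 0 <= G p 0.
  by case: (src p) => _ _ f0 _ _; rewrite divr_ge0// ltW.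
have Gmono p u w : 0 <= u -> u <= w -> w < 1 -> G p u <= G p w.
  move=> u0 uw w1; rewrite ler_pM2r ?invr_gt0//.
  exact: source_nondecreasing (src p) u0 uw w1.
have Glsc p u e : 0 <= u < 1 -> 0 < e -> exists2 h, 0 < h &
    forall w, 0 <= w < 1 -> u - h < w -> G p u - e < G p w.
  move=> u01 e0.
  have [h h0 Hh] := source_lower_semicontinuous (src p) u01
    (mulr_gt0 e0 (s0 p)).
  exists h => // w w01 uw; rewrite ltr_pdivlMr// mulrBl divfK ?gt_eqF//.
  exact: Hh.
have Mg' p : 0 < (M *m v) p 0 + G p (v p 0).
  by have := wv p; rewrite /slope -/(g v) gE mxE [ltRHS]mxE [X in _ + X]mxE.
have Moff p q : p != q -> 0 <= M p q by exact: Mxy_offdiag_ge0.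
have [e /= e0 He] :=
  implicit_step_increasing Moff bE XE G0 Gmono Glsc htheta v01 Mg'.
exists (e / 2) => [|t v' /andP[t0 te] v'01 sv']; first by rewrite divr_gt0.
have te' : ball (0 : R) e t.
  rewrite /ball/= sub0r normrN ger0_norm ?ltW// (le_lt_trans te)//.
  by rewrite ltr_pdivrMr// ltr_pMr// ltrDl.
have [] := He t te' t0 v' v'01; last first.
  move=> inc w'_gt0; split=> // p.
  by rewrite /slope -/(g v') gE mxE [ltRHS]mxE [X in _ + X]mxE.
move: sv'; rewrite /scheme_step -/(Phi Nx Ny a b x y sigma t).
rewrite -[gvec _ _ _ _ _ v]/(g v) -[gvec _ _ _ _ _ v']/(g v') !gE => {1}->.
rewrite mulmxA mulmxA mulmxV// mul1mx mulmxBl mul1mx.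
by rewrite addrAC.
Qed.

Theorem theorem4p1 (R : realType) (Nx Ny : nat) (a b : R) (x y : nat -> R)
    (sigma : R * R -> R) (eps : R * R -> R) (f : R -> R -> R) (theta : R)
    (hNx : (0 < Nx)%N) (hNy : (0 < Ny)%N) (ha : 0 < a) (hb : 0 < b)
    (hx : is_grid Nx x) (hy : is_grid Ny y)
    (hsigma : is_degeneracy sigma) (hf : is_reaction eps f)
    (htheta : 0 <= theta <= 1) :
  exists taustar : 'cV[R]_(Ny * Nx) -> R,
    (forall v, in01 v -> 0 < taustar v) /\
    forall (k0 : nat) (v : nat -> 'cV[R]_(Ny * Nx)) (tau : nat -> R),
      ltcv 0 (Mxy Nx Ny a b x y sigma *m v k0 + gvec x y sigma eps f (v k0)) ->
      (forall k, (k0 <= k)%N -> in01 (v k) -> 0 < tau k <= taustar (v k)) ->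
      (forall k, (k0 <= k)%N -> in01 (v k) -> in01 (v k.+1) ->
         scheme_step a b x y sigma eps f theta (tau k) (v k) (v k.+1)) ->
      forall k, (k0 <= k)%N ->
        (forall j, (k0 <= j <= k.+1)%N -> in01 (v j)) ->
        ltcv (v k) (v k.+1).
Proof.
pose M := Mxy Nx Ny a b x y sigma.
pose g := gvec (Nx := Nx) (Ny := Ny) x y sigma eps f.
pose good (v : 'cV[R]_(Ny * Nx)) := in01 v /\ ltcv 0 (M *m v + g v).
have step_ok v : good v -> exists2 t0 : R, 0 < t0 &
    forall t v', 0 < t <= t0 -> in01 v' ->
      scheme_step a b x y sigma eps f theta t v v' -> ltcv v v' /\ good v'.
  move=> [v01 wv].
  have [t0 t0_gt0 Ht0] :=
    scheme_step_increasing ha hb hx hy hsigma hf htheta v01 wv.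
  exists t0 => // t v' tt0 v'01 /(Ht0 _ _ tt0 v'01)[inc wv'].
  by split.
have /choice[taustar taustarP] : forall v : 'cV[R]_(Ny * Nx), exists t0 : R,
    0 < t0 /\ (good v -> forall t v', 0 < t <= t0 -> in01 v' ->
      scheme_step a b x y sigma eps f theta t v v' -> ltcv v v' /\ good v').
  move=> v; have [/step_ok[t0 t0_gt0 Ht0]|ngood] := pselect (good v).
    by exists t0; split.
  by exists 1; split=> [|/ngood//]; exact: ltr01.
exists taustar; split=> [v _|k0 v tau Mg0 tau_le sstep].
  by case: (taustarP v).
have next k : (k0 <= k)%N -> good (v k) -> in01 (v k.+1) ->
    ltcv (v k) (v k.+1) /\ good (v k.+1).
  move=> k0k gk v01; have [vk01 _] := gk.
  have [_ /(_ gk)] := taustarP (v k).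
  by apply; [exact: tau_le|exact: v01|exact: sstep].
have good_all k : (k0 <= k)%N -> (forall j, (k0 <= j <= k)%N -> in01 (v j)) ->
    good (v k).
  elim: k => [|k IHk].
    rewrite leqn0 => /eqP k00 v01; move: Mg0; rewrite k00 => Mg0.
    by split=> //; apply: v01; rewrite k00.
  rewrite leq_eqVlt => /orP[/eqP <- v01|].
    by split=> //; apply: v01; rewrite leqnn.
  rewrite ltnS => k0k v01; have gk : good (v k).
    by apply: IHk => // j /andP[k0j jk]; apply: v01; rewrite k0j leqW.
  have vk1 : in01 (v k.+1) by apply: v01; rewrite leqnn leqW.
  by have [] := next k k0k gk vk1.
move=> k k0k v01.
have gk : good (v k).
  by apply: good_all => // j /andP[k0j jk]; apply: v01; rewrite k0j leqW.
have vk1 : in01 (v k.+1) by apply: v01; rewrite leqnn leqW.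
by have [] := next k k0k gk vk1.
Qed.
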